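(* Let $n\in\mathbb{N}$, $p\in(0,1)$, $q=1-p$, and let $U_N=\bigcup_{k=1}^N G_k$ be the union of $N$ independent random graphs $G_k\in\mathcal{G}(n,p)$ on the common node set $[n]$. Let $\lambda_{min}=2\left(1-\cos\frac{\pi}{n}\right)$ be the minimum algebraic connectivity of a connected graph on $n$ nodes. If \[ N\ge N_{min}:=\frac{1}{\log q}\log\left(\frac{4n^2+4n\cos\frac{\pi}{n}-\tau(n)-8n}{6n^2-8n}\right), \] where \[ \tau(n):=\bigg(16n^2(n-2)\Big(1-\cos\frac{\pi}{n}\Big)+32n(2-n)\Big(1-\cos\frac{\pi}{n}\Big)^2+4n^2(n-2)^2\bigg)^{1/2}, \] then $\mathbb{E}[\lambda_2(U_N)]\ge\lambda_{min}$.
   Context: $\mathcal{G}(n,p)$ denotes the Erdős–Rényi model: a simple undirected graph on nodes $[n]$ in which each of the $\binom{n}{2}$ possible edges is present independently with probability $p$. The union of graphs on the same node set has as edge set the union of their edge sets. For a graph with Laplacian $L=D-A$ (degree matrix minus adjacency matrix) and eigenvalues $0=\lambda_1\le\lambda_2\le\dots\le\lambda_n$, the algebraic connectivity is $\lambda_2$; $\lambda_2(U_N)$ is the algebraic connectivity of $U_N$. *)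

(* Defs.v *)
From HB Require Import structures.
From mathcomp Require Import all_boot all_order all_algebra.
From mathcomp Require Import boolp classical_sets reals trigo exp.
Unset Printing Implicit Defensive.
Import Order.TTheory GRing.Theory Num.Theory.
Local Open Scope ring_scope.

(* A simple undirected graph on nodes 'I_n is encoded by its edge set:
   a set of ordered pairs (i, j) with i < j (each unordered edge {i,j}
   is stored once, as (min, max)). *)
Definition pairs (n : nat) : {set 'I_n * 'I_n} := [set e : 'I_n * 'I_n | (e.1 < e.2)%N].

Definition is_graph (n : nat) (E : {set 'I_n * 'I_n}) : bool := E \subset pairs n.

Definition adj (n : nat) (E : {set 'I_n * 'I_n}) (i j : 'I_n) : bool :=
  ((i, j) \in E) || ((j, i) \in E).

Definition laplacian (R : realType) (n : nat) (E : {set 'I_n * 'I_n}) : 'M[R]_n :=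
  \matrix_(i, j) ((if i == j then #|[set k | adj n E i k]|%:R else 0)
                   - (if adj n E i j then 1 else 0)).

Definition spectrum (R : realType) (n : nat) (M : 'M[R]_n) : seq R :=
  xget [::] [set s : seq R | sorted <=%R s /\
                 char_poly M = \prod_(x <- s) ('X - x%:P)].

Definition lambda2 (R : realType) (n : nat) (E : {set 'I_n * 'I_n}) : R :=
  nth 0 (spectrum R n (laplacian R n E)) 1.

Definition gnp_prob (R : realType) (n : nat) (p : R) (E : {set 'I_n * 'I_n}) : R :=
  if is_graph n E then p ^+ #|E| * (1 - p) ^+ (#|pairs n| - #|E|) else 0.

Definition union_graph (n N : nat) (Gs : {ffun 'I_N -> {set 'I_n * 'I_n}})
  : {set 'I_n * 'I_n} := \bigcup_(k < N) Gs k.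

Definition exp_lambda2_union (R : realType) (n N : nat) (p : R) : R :=
  \sum_(Gs : {ffun 'I_N -> {set 'I_n * 'I_n}})
     (\prod_(k < N) gnp_prob R n p (Gs k)) * lambda2 R n (union_graph n N Gs).

Definition lambda_min (R : realType) (n : nat) : R := 2 * (1 - cos (pi / n%:R)).

Definition tau (R : realType) (n : nat) : R :=
  let c := 1 - cos (pi / n%:R) in
  Num.sqrt (16 * n%:R ^+ 2 * (n%:R - 2) * c + 32 * n%:R * (2 - n%:R) * c ^+ 2
            + 4 * n%:R ^+ 2 * (n%:R - 2) ^+ 2).

Definition N_min (R : realType) (n : nat) (p : R) : R :=
  (ln ((4 * n%:R ^+ 2 + 4 * n%:R * cos (pi / n%:R) - tau R n - 8 * n%:R)
       / (6 * n%:R ^+ 2 - 8 * n%:R))) / ln (1 - p).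

(* Main.v *)
(* Let [P = 1 - (1 - p) ^ N] be the edge probability of the union [U], [L] its
   Laplacian and [k = n - 1]. As the spectrum of [L] is [0 <= lambda_2 <= ...],
   Cauchy-Schwarz on the [n - 2] largest eigenvalues gives
   [(tr L - lambda_2)^2 <= (n - 2) (tr L^2 - lambda_2^2)], that is
   [(k lambda_2 - tr L)^2 + (k - 1) (tr L)^2 <= k (k - 1) tr L^2].
   Taking expectations and applying Jensen's inequality to both squares,
   [(E lambda_2 - n P)^2 <= 2 n (n - 2) P (1 - P)], since
   [E tr L = n k P] and [E tr L^2 = n k (2 P + (n - 2) P^2)]. The condition
   [N >= N_min] says exactly that [(1 - p) ^ N] is at most the smaller root of
   the quadratic [(n P - lambda_min)^2 = 2 n (n - 2) P (1 - P)], below which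
   [n P >= lambda_min]. *)
Require Import Defs.
From HB Require Import structures.
From mathcomp Require Import all_boot all_order all_algebra complex.
From mathcomp Require Import ring lra.
From mathcomp Require Import boolp classical_sets reals trigo exp.
Import Order.TTheory GRing.Theory Num.Theory.
Local Open Scope ring_scope.

(** * Diagonalization of real symmetric matrices, and Cauchy-Schwarz *)

Lemma char_poly_conj (F : fieldType) n (P A : 'M[F]_n) : P \in unitmx ->
  char_poly (invmx P *m A *m P) = char_poly A.
Proof.
move=> Pu; rewrite /char_poly.
have -> : char_poly_mx (invmx P *m A *m P) =
   map_mx polyC (invmx P) *m char_poly_mx A *m map_mx polyC P.
  rewrite /char_poly_mx mulmxBr mulmxBl !map_mxM /=; congr (_ - _).
  by rewrite -mulmxA mul_scalar_mx -scalemxAr -map_mxM mulVmx // map_mx1 scalemx1.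
by rewrite !det_mulmx mulrAC -det_mulmx -map_mxM mulVmx // map_mx1 det1 mul1r.
Qed.

(** Over [R[i]] the matrix is Hermitian, hence unitarily diagonalizable with real eigenvalues; each
    identity descends to [R] because the embedding [f] is injective. *)
Lemma symmetric_char_poly_split (R : rcfType) n (A : 'M[R]_n) : A^T = A ->
  exists d : 'I_n -> R,
    [/\ char_poly A = \prod_i ('X - (d i)%:P), \tr A = \sum_i d i &
        \tr (A *m A) = \sum_i d i ^+ 2].
Proof.
move=> symA; pose f : {rmorphism R -> R[i]%C} := real_complex R.
pose Ac := map_mx f A; pose D := spectral_diag Ac; pose P := spectralmx Ac.
have Ah : Ac \is hermsymmx.
  apply: realsym_hermsym.
    by apply/is_hermitianmxP; rewrite expr0 scale1r map_mx_id // /Ac map_trmx symA.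
  by apply/mxOverP => i j; rewrite mxE; apply/complex_realP; exists (A i j).
have Dr := hermitian_spectral_diag_real Ah.
have /orthomx_spectralP AE := hermitian_normalmx Ah.
have Pu : P \in unitmx by apply: spectral_unit.
pose d i := complex.Re (D 0 i).
have DE i : D 0 i = f (d i).
  by rewrite /f /d /= RRe_real //; exact: (mxOverP Dr).
have finj : injective f by apply: complexI.
exists d; split.
- apply: (map_poly_inj f); rewrite map_char_poly -/Ac AE char_poly_conj //.
  rewrite char_poly_trig ?diag_mx_is_trig // rmorph_prod /=.
  by apply: eq_bigr => i _; rewrite mxE eqxx mulr1n -/D DE map_polyXsubC.
- apply: finj; rewrite -trace_map_mx -/Ac AE mxtrace_mulC mulKVmx // mxtrace_diag raddf_sum.
  by apply: eq_bigr => i _; rewrite -/D DE.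
- apply: finj; rewrite -trace_map_mx map_mxM -/Ac AE.
  rewrite -/P -/D !mulmxA -(mulmxA _ P) mulmxV // mulmx1 mxtrace_mulC !mulmxA mulmxV // mul1mx.
  rewrite raddf_sum; apply: eq_bigr => i _.
  by rewrite mul_diag_mx !mxE eqxx mulr1n DE expr2 [RHS]rmorphM.
Qed.

(** Cauchy-Schwarz against the constant 1. The quantity in [var_ge0] is the expanded sum of
    [(x - a) ^+ 2], which is exactly the slack gained when [a] is prepended. *)
Lemma sqr_sum_seq (R : realFieldType) (s : seq R) :
  (\sum_(x <- s) x) ^+ 2 <= (size s)%:R * \sum_(x <- s) x ^+ 2.
Proof.
have var_ge0 (a : R) (t : seq R) :
    0 <= (size t)%:R * a ^+ 2 - 2 * a * (\sum_(x <- t) x) + \sum_(x <- t) x ^+ 2.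
  elim: t => [|x t IH]; first by rewrite !big_nil mul0r mulr0 subr0 addr0.
  by rewrite !big_cons /= -natr1; have := sqr_ge0 (x - a); nra.
elim: s => [|a s IH]; first by rewrite !big_nil mul0r expr0n.
rewrite !big_cons /= -natr1; have := var_ge0 a s; nra.
Qed.

(** * The Laplacian and its spectrum *)

Lemma sum_mulrb (V : nmodType) (I : finType) (F : I -> V) j :
  \sum_i F i *+ (i == j) = F j.
Proof. by under eq_bigr do rewrite mulrb; rewrite -big_mkcond big_pred1_eq. Qed.

Lemma adjC n (E : {set 'I_n * 'I_n}) i j : adj n E i j = adj n E j i.
Proof. by rewrite /adj orbC. Qed.

Lemma laplacianE (R : realType) n (E : {set 'I_n * 'I_n}) i j :
  laplacian R n E i j =
    (\sum_k (adj n E i k)%:R) *+ (i == j) - (adj n E i j)%:R.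
Proof.
rewrite mxE -sum1_card natr_sum big_mkcond /=; congr (_ - _); last by case: adj.
case: eqP => // _; rewrite mulr1n; apply: eq_bigr => k _.
by rewrite inE; case: adj.
Qed.

Lemma trmx_laplacian (R : realType) n (E : {set 'I_n * 'I_n}) :
  (laplacian R n E)^T = laplacian R n E.
Proof.
apply/matrixP => i j; rewrite mxE !laplacianE adjC eq_sym.
by case: eqP => // ->.
Qed.

(** The columns sum to zero, so the all-ones row vector is an eigenvector. *)
Lemma laplacian_ev0 (R : realType) n (E : {set 'I_n * 'I_n}) : (0 < n)%N ->
  eigenvalue (laplacian R n E) 0.
Proof.
move=> n_gt0; apply/eigenvalueP; exists (const_mx 1); last first.
  by apply/eqP => /rowP /(_ (Ordinal n_gt0)) /eqP; rewrite !mxE oner_eq0.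
apply/rowP => j; rewrite scale0r !mxE.
under eq_bigr do rewrite mxE mul1r laplacianE.
rewrite sumrB sum_mulrb; apply/eqP; rewrite subr_eq0; apply/eqP/eq_bigr => i _; by rewrite adjC.
Qed.

(** Adding [q1] to its copy [q2] with [i] and [j] exchanged turns [2 a |v|^2] into the sum of
    [w i j * (v_i - v_j)^2]. *)
Lemma laplacian_ev_ge0 (R : realType) n (E : {set 'I_n * 'I_n}) a :
  eigenvalue (laplacian R n E) a -> 0 <= a.
Proof.
move=> /eigenvalueP[v vL v_neq0]; pose w i j : R := (adj n E i j)%:R.
have ev j : v 0 j * (\sum_i w i j) - \sum_i v 0 i * w i j = a * v 0 j.
  have := congr1 (fun u : 'rV_n => u 0 j) vL; rewrite !mxE => <-.
  under [RHS]eq_bigr do rewrite laplacianE mulrBr.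
  rewrite sumrB; congr (_ - _).
  under [RHS]eq_bigr do rewrite mulrnAr.
  by rewrite sum_mulrb; congr (_ * _); apply: eq_bigr => i _; rewrite adjC.
have q1 : a * (\sum_j v 0 j ^+ 2) = \sum_j \sum_i w i j * (v 0 j ^+ 2 - v 0 i * v 0 j).
  rewrite mulr_sumr; apply: eq_bigr => j _.
  rewrite expr2 mulrA -ev mulrBl mulrAC mulr_sumr mulr_suml -sumrB.
  by apply: eq_bigr => i _; ring.
have q2 : a * (\sum_j v 0 j ^+ 2) = \sum_j \sum_i w i j * (v 0 i ^+ 2 - v 0 i * v 0 j).
  rewrite q1 exchange_big /=; apply: eq_bigr => j _; apply: eq_bigr => i _.
  by rewrite /w adjC (mulrC (v 0 j)).
have sv_gt0 : 0 < \sum_j v 0 j ^+ 2.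
  have /rV0Pn[k vk] := v_neq0.
  rewrite (bigD1 k) //= ltr_pwDl ?exprn_even_gt0 ?vk ?orbT //.
  by apply: sumr_ge0 => i _; exact: sqr_ge0.
rewrite -(pmulr_lge0 _ sv_gt0) -(pmulr_rge0 _ (ltr0Sn R 1)) mulr_natl mulr2n.
rewrite {1}q1 q2 -big_split sumr_ge0 //= => j _; rewrite -big_split sumr_ge0 //= => i _.
have -> : w i j * (v 0 j ^+ 2 - v 0 i * v 0 j) + w i j * (v 0 i ^+ 2 - v 0 i * v 0 j)
  = w i j * (v 0 i - v 0 j) ^+ 2 by ring.
by rewrite mulr_ge0 ?ler0n ?sqr_ge0.
Qed.

(** For symmetric matrices the default [[::]] of [xget] is never taken: sorting the diagonal entries
    gives a witness. *)
Lemma spectrumP (R : realType) n (A : 'M[R]_n) : A^T = A ->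
  sorted <=%R (spectrum R n A) /\ char_poly A = \prod_(x <- spectrum R n A) ('X - x%:P).
Proof.
move=> symA; rewrite /spectrum.
apply: (@xgetPex _ [::] [set s : seq R | sorted <=%R s /\
  char_poly A = \prod_(x <- s) ('X - x%:P)]%classic).
have [d [-> _ _]] := symmetric_char_poly_split _ _ _ symA.
exists (sort <=%R [seq d i | i <- enum 'I_n]); split.
  exact: (sort_sorted (@le_total _ R)).
by rewrite (perm_big _ (permEl (perm_sort _ _))) /= big_map enumT.
Qed.

Lemma spectrum_trace (R : realType) n (A : 'M[R]_n) (s := spectrum R n A) :
  A^T = A ->
  [/\ size s = n, \tr A = \sum_(x <- s) x & \tr (A *m A) = \sum_(x <- s) x ^+ 2].
Proof.
move=> symA; have [d [pd -> ->]] := symmetric_char_poly_split _ _ _ symA.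
have [_] := spectrumP _ _ _ symA; rewrite -/s pd => /esym sE.
have /prod_XsubC_eq sd : \prod_(x <- s) ('X - x%:P) =
    \prod_(x <- [seq d i | i <- enum 'I_n]) ('X - x%:P).
  by rewrite sE big_map enumT.
rewrite !(perm_big _ sd) (perm_size sd) size_map size_enum_ord !big_map.
by [].
Qed.

Lemma lambda2_trace (R : realType) n (E : {set 'I_n * 'I_n}) (L := laplacian R n E) :
  (1 < n)%N ->
  (\tr L - lambda2 R n E) ^+ 2 <=
     (n%:R - 2) * (\tr (L *m L) - lambda2 R n E ^+ 2).
Proof.
move=> n_gt1; have symL := trmx_laplacian R n E.
have [ss] := spectrumP _ _ _ symL; have [sn -> ->] := spectrum_trace _ _ _ symL.
rewrite /lambda2 -/L; set s := spectrum R n L in sn ss * => sE.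
have ms x : (x \in s) = eigenvalue L x.
  by rewrite eigenvalue_root_char sE root_prod_XsubC.
have s0 : 0 \in s by rewrite ms laplacian_ev0 // ltnW.
have sge0 x : x \in s -> 0 <= x by rewrite ms; apply: laplacian_ev_ge0.
case: s {sE ms} ss sn s0 sge0 => [|x [|y r]] /=;
  [by move=> _ <-|by move=> _ sn; rewrite -sn in n_gt1|].
move=> ss sn s0 sge0.
(* The list is sorted, nonnegative and contains 0, so its head is 0. Then [y] is [lambda2], and
   Cauchy-Schwarz applies to the [n - 2] entries of [r]. *)
have x0 : x = 0.
  apply/le_anti; rewrite sge0 ?mem_head // andbT.
  have : all (<=%R x) (y :: r) by apply: (order_path_min le_trans).
  move: s0; rewrite inE => /orP[/eqP -> //|s0 /allP /(_ _ s0) //].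
rewrite -sn x0 !big_cons -!natr1 add0r expr0n /= add0r.
have := sqr_sum_seq _ r.
by rewrite (addrC y) !addrK add0r (addrC (y ^+ 2)) addrK -[_ + 1 + 1]addrA addrK.
Qed.

(** * Avoidance probabilities and expectations over the union *)

(** Distributivity expands the product of [F e + G e] into a sum over edge sets, with [F] weighing a
    present pair outside [S] and [G] an absent pair. A factor is [1 - p] on [S :&: pairs n] and 1
    elsewhere. *)
Lemma gnp_prob_disjoint (R : realType) n (p : R) (S : {set 'I_n * 'I_n}) :
  \sum_E gnp_prob R n p E * [disjoint S & E]%:R = (1 - p) ^+ #|S :&: pairs n|.
Proof.
pose F e : R := if e \in pairs n :\: S then p else 0.
pose G e : R := if e \in pairs n then 1 - p else 1.
transitivity (\prod_e (F e + G e)); last first.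
  rewrite -prodr_const [RHS]big_mkcond; apply: eq_bigr => e _.
  by rewrite /F /G !inE; case: (e \in S); case: (e.1 < e.2)%N => /=; ring.
rewrite bigA_distr; apply: eq_bigr => E _; rewrite (bigID (mem E)) /=.
have -> : \prod_(e in E) (if e \in E then F e else G e) = \prod_(e in E) F e.
  by apply: eq_bigr => e ->.
have [/fintype.subsetP sub | nsub] := boolP (E \subset pairs n :\: S).
  have dSE : [disjoint S & E].
    rewrite disjoint_sym disjoint_subset.
    by apply/fintype.subsetP => e /sub; rewrite !inE => /andP[].
  have gE : E \subset pairs n by apply/fintype.subsetP => e /sub; rewrite inE => /andP[].
  rewrite dSE mulr1 /gnp_prob /is_graph gE; congr (_ * _).
    by rewrite -prodr_const; apply: eq_bigr => e eE; rewrite /F sub.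
  have -> : (#|pairs n| - #|E|)%N = #|pairs n :\: E| by rewrite finset.cardsD (finset.setIidPr gE).
  rewrite -prodr_const (eq_bigl (fun e => (e \notin E) && (e \in pairs n))); last first.
    by move=> e; rewrite finset.in_setD.
  rewrite [LHS]big_mkcondr; apply: eq_bigr => e /negPf eE.
  by rewrite /G eE.
(* Both sides vanish here: [E] is not a graph or it meets [S]. *)
have [e eE eN] := fintype.subsetPn nsub.
rewrite [X in _ = X * _](bigD1 e) //= {1}/F (negPf eN) !mul0r.
rewrite /gnp_prob /is_graph; case: ifP => [/fintype.subsetP gE|_]; last by rewrite mul0r.
case: (boolP [disjoint S & E]) => [|_]; last by rewrite mulr0.
move: eN; rewrite finset.in_setD gE // andbT negbK => eS.
by move=> /disjointFr /(_ eS); rewrite eE.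
Qed.

(** At [f := lambda2 R n] this is convertible to [exp_lambda2_union]. *)
Definition expect (R : realType) n N (p : R) (f : {set 'I_n * 'I_n} -> R) : R :=
  \sum_(Gs : {ffun 'I_N -> {set 'I_n * 'I_n}})
     (\prod_(k < N) gnp_prob R n p (Gs k)) * f (union_graph n N Gs).
Arguments expect {R n} N p f.

(** The union avoids [S] iff every [Gs k] does, and independence factors the probability. Total mass
    and all edge moments below are derived from this formula. *)
Lemma expect_disjoint (R : realType) n N (p : R) (S : {set 'I_n * 'I_n}) :
  expect N p (fun U => [disjoint S & U]%:R) = ((1 - p) ^+ N) ^+ #|S :&: pairs n|.
Proof.
rewrite exprAC -(gnp_prob_disjoint R n p S).
rewrite -[in RHS](card_ord N) -prodr_const bigA_distr_bigA /expect.
apply: eq_bigr => Gs _; rewrite big_split /=; congr (_ * _).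
have -> : [disjoint S & union_graph n N Gs] = [forall k, [disjoint S & Gs k]].
  by apply/finset.bigcup_disjointP/forallP => dS k *; apply: dS.
case: forallP => [dS|/forallP]; first by rewrite big1 // => k _; rewrite dS.
by rewrite negb_forall => /existsP[k /negPf dS]; rewrite (bigD1 k) //= dS mul0r.
Qed.

Section expectation.
Context {R : realType} {n N : nat} {p : R}.
Implicit Types f g : {set 'I_n * 'I_n} -> R.
Local Notation EE := (@expect R n N p).

Lemma eq_expect f g : f =1 g -> EE f = EE g.
Proof. by move=> fg; apply: eq_bigr => Gs _; rewrite fg. Qed.

Lemma expectD f g : EE (fun U => f U + g U) = EE f + EE g.
Proof. by rewrite -big_split; apply: eq_bigr => Gs _; rewrite mulrDr. Qed.

Lemma expectZ a f : EE (fun U => a * f U) = a * EE f.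
Proof. by rewrite mulr_sumr; apply: eq_bigr => Gs _; rewrite mulrCA. Qed.

Lemma expectB f g : EE (fun U => f U - g U) = EE f - EE g.
Proof. by rewrite -sumrB; apply: eq_bigr => Gs _; rewrite mulrBr. Qed.

Lemma expect_sum (I : finType) (P : pred I) (f : I -> {set 'I_n * 'I_n} -> R) :
  EE (fun U => \sum_(i | P i) f i U) = \sum_(i | P i) EE (f i).
Proof. by rewrite exchange_big; apply: eq_bigr => Gs _; rewrite mulr_sumr. Qed.

Lemma expect_cst a : EE (fun=> a) = a.
Proof.
have := expect_disjoint R n N p finset.set0; rewrite finset.set0I finset.cards0 expr0 => E1.
rewrite -[RHS]mulr1 -E1 -expectZ; apply: eq_expect => U.
by rewrite -finset.setI_eq0 finset.set0I eqxx mulr1.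
Qed.

Lemma le_expect f g : 0 <= p <= 1 -> (forall U, f U <= g U) -> EE f <= EE g.
Proof.
move=> /andP[p0 p1] fg; apply: ler_sum => Gs _; apply: ler_wpM2l => //.
apply: prodr_ge0 => k _; rewrite /gnp_prob; case: ifP => // _.
by rewrite mulr_ge0 // exprn_ge0 // subr_ge0.
Qed.

End expectation.

(** * First and second moments of the Laplacian trace *)

Lemma adj_disjoint n (E : {set 'I_n * 'I_n}) i j :
  adj n E i j = ~~ [disjoint [set (i, j); (j, i)] & E].
Proof.
rewrite -finset.setI_eq0; apply/orP/finset.set0Pn.
  by case=> h; [exists (i, j)|exists (j, i)]; rewrite !inE eqxx ?orbT.
by move=> [e]; rewrite !inE => /andP[/orP[]/eqP-> h]; [left|right].
Qed.

Definition edge n (i j : 'I_n) : 'I_n * 'I_n := if (i < j)%N then (i, j) else (j, i).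

Lemma edge_pairs n (i j : 'I_n) : i != j ->
  [set (i, j); (j, i)] :&: pairs n = [set edge n i j].
Proof.
move=> ij; apply/finset.setP => -[a b]; rewrite !inE /edge /=.
have : (i : nat) != j by [].
case: (ltngtP i j) => // h _.
- case: eqP => [[-> ->]|_] /=; first by rewrite h.
  by case: eqP => [[-> ->]|//] /=; rewrite ltnNge ltnW // -xpair_eqE.
- case: eqP => [[-> ->]|_] /=; last by case: eqP => [[-> ->]|//] /=.
  by rewrite ltnNge ltnW //= xpair_eqE (negPf ij).
Qed.

Section moments.
Variables (R : realType) (n N : nat) (p : R).
Let x := (1 - p) ^+ N.
Let P := 1 - x.
Local Notation EE := (@expect R n N p).

Lemma expect_adj i j : i != j -> EE (fun U => (adj n U i j)%:R) = P.
Proof.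
move=> ij; rewrite (eq_expect _ (fun U => 1 - [disjoint [set (i, j); (j, i)] & U]%:R)).
  by rewrite expectB expect_cst expect_disjoint edge_pairs // cards1 expr1.
by move=> U; rewrite adj_disjoint; case: [disjoint _ & _] => /=; ring.
Qed.

(** For 0/1 values, [a b = a + b - 1 + (1 - a) (1 - b)], and the last product indicates that two
    distinct edges are both avoided. *)
Lemma expect_adj2 i j k : i != j -> i != k -> j != k ->
  EE (fun U => (adj n U i j)%:R * (adj n U i k)%:R) = P ^+ 2.
Proof.
move=> ij ik jk.
pose S j := [set (i, j); (j, i)].
rewrite (eq_expect _ (fun U => (adj n U i j)%:R + (adj n U i k)%:R - 1
   + [disjoint S j :|: S k & U]%:R)).
  rewrite expectD expectB expectD expect_cst !expect_adj // expect_disjoint.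
  rewrite finset.setIUl !edge_pairs // cards2.
  have -> : edge n i j != edge n i k.
    by apply: contra_neq jk; rewrite /edge; case: ifP => _; case: ifP => _ [] // *; subst.
  by rewrite /P -/x; ring.
move=> U; rewrite !adj_disjoint.
have -> : [disjoint S j :|: S k & U] = [disjoint S j & U] && [disjoint S k & U].
  by rewrite -!finset.setI_eq0 finset.setIUl finset.setU_eq0.
by rewrite /S; do 2 case: [disjoint _ & _] => /=; ring.
Qed.

Lemma sum_offdiag (c : R) : \sum_(i < n) \sum_(j | j != i) c = n%:R * (n%:R - 1) * c.
Proof.
have -> : \sum_(i < n) \sum_(j | j != i) c = \sum_(i < n) ((n%:R - 1) * c).
  apply: eq_bigr => i _; apply: (addrI c).
  have <- : \sum_(j < n) c = c + \sum_(j < n | j != i) c by rewrite (bigD1 i).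
  by rewrite sumr_const card_ord -mulr_natl; ring.
by rewrite sumr_const card_ord -[LHS]mulr_natl mulrA.
Qed.

Lemma laplacian_diag (E : {set 'I_n * 'I_n}) i :
  laplacian R n E i i = \sum_(j | j != i) (adj n E i j)%:R.
Proof. by rewrite laplacianE eqxx mulr1n (bigD1 i) //= addrC addrK. Qed.

Lemma expect_tr :
  EE (fun U => \tr (laplacian R n U)) = n%:R * (n%:R - 1) * P.
Proof.
rewrite (eq_expect _ (fun U => \sum_i \sum_(j | j != i) (adj n U i j)%:R)); last first.
  by move=> U; apply: eq_bigr => i _; rewrite laplacian_diag.
rewrite expect_sum -sum_offdiag; apply: eq_bigr => i _.
by rewrite expect_sum; apply: eq_bigr => j ji; rewrite expect_adj // eq_sym.
Qed.

(** Row [i] contributes its squared degree and its squared off-diagonal entries. As [adj] is 0/1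
    valued, the terms [j = k] of the squared degree and those entries each give one [adj n E i j],
    whence the 2. *)
Lemma mxtrace_laplacian_sqr (E : {set 'I_n * 'I_n}) :
  let L := laplacian R n E in
  \tr (L *m L) = \sum_i \sum_(j | j != i) (2 * (adj n E i j)%:R +
     \sum_(k | (k != i) && (k != j)) (adj n E i j)%:R * (adj n E i k)%:R).
Proof.
move=> L; apply: eq_bigr => i _; rewrite mxE (bigD1 i) //=.
rewrite laplacian_diag mulr_suml -big_split /=; apply: eq_bigr => j ji.
rewrite mulr_sumr (bigD1 j) //= !laplacianE eq_sym (negPf ji) (adjC n E j i).
by rewrite mulr0n sub0r mulrNN addrAC; congr (_ + _); case: adj => /=; ring.
Qed.

Lemma expect_tr_sqr (L := laplacian R n) :
  EE (fun U => \tr (L U *m L U)) =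
  n%:R * (n%:R - 1) * (2 * P + (n%:R - 2) * P ^+ 2).
Proof.
rewrite (eq_expect _ _ mxtrace_laplacian_sqr) expect_sum -sum_offdiag.
apply: eq_bigr => i _; rewrite expect_sum; apply: eq_bigr => j ji.
rewrite expectD expectZ expect_adj 1?eq_sym // expect_sum; congr (_ + _).
rewrite (eq_bigr (fun=> P ^+ 2)) => [|k /andP[ki kj]]; last first.
  by rewrite expect_adj2 // eq_sym.
rewrite sumr_const -[LHS]mulr_natl; congr (_ * _).
have <- : (n - 2)%N = #|[pred k | (k != i) && (k != j)]|.
  have /(congr1 (subn^~ 2)) := cardC (pred2 i j).
  rewrite card2 eq_sym ji card_ord addKn => <-.
  by apply: eq_card => k; rewrite !inE negb_or.
(* Truncated subtraction is harmless: the distinct [i] and [j] force [n] to be at least 2. *)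
rewrite natrB //; case: (n) i j ji => [[]|[|//]] //.
by move=> i j; rewrite !ord1.
Qed.

End moments.

(** * From the moments to the bound on the expectation *)

Lemma expect_lambda2_ge (R : realType) n N (p l : R) (P := 1 - (1 - p) ^+ N) :
  (1 < n)%N -> 0 <= p <= 1 -> l <= n%:R * P ->
  2 * n%:R * (n%:R - 2) * P * (1 - P) <= (n%:R * P - l) ^+ 2 ->
  l <= exp_lambda2_union R n N p.
Proof.
move=> n_gt1 p01 lm hvar.
pose k : R := n%:R - 1; pose m := n%:R * P.
have k_gt0 : 0 < k by rewrite subr_gt0 ltr1n.
have k1 : 0 <= k - 1 by have : 2 <= n%:R :> R; [rewrite ler_nat | rewrite /k; lra].
change (exp_lambda2_union R n N p) with (expect N p (lambda2 R n)).
set X := expect N p (lambda2 R n).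
(* Since [k * m] is the mean of [\tr L], [c] is the mean of [k * lambda2 - \tr L]. *)
pose c := k * X - k * m.
pose L := laplacian R n.
have : expect N p (fun U => (2 * c * k) * lambda2 R n U +
     ((2 * (k - 1) * k * m - 2 * c) * \tr (L U) - (c ^+ 2 + (k - 1) * k ^+ 2 * m ^+ 2)))
   <= expect N p (fun U => k * (k - 1) * \tr (L U *m L U)).
  (* Jensen in linearised form: [y ^ 2 >= 2 c y - c ^ 2] with [c] the mean of [y]. *)
  apply: le_expect => // U; have := lambda2_trace R n U n_gt1; rewrite -/(L U).
  set Y := lambda2 _ _ _; set T := \tr (L U); set Q := \tr (_ *m _).
  have -> : n%:R - 2 = k - 1 by rewrite /k; ring.
  move=> h.
  have h1 : (k * Y - T) ^+ 2 + (k - 1) * T ^+ 2 <= k * (k - 1) * Q.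
    by have := ler_wpM2l (ltW k_gt0) h; lra.
  have h2 := sqr_ge0 (k * Y - T - c).
  have h3 := mulr_ge0 k1 (sqr_ge0 (T - k * m)).
  rewrite -subr_ge0 in h1; rewrite -subr_ge0.
  have := addr_ge0 h1 (addr_ge0 h2 h3); congr (_ <= _); ring.
rewrite expectD !expectZ expectB expectZ expect_cst expect_tr expect_tr_sqr -/P -/X.
rewrite -/k => hX.
have {}hX : (X - m) ^+ 2 <= (m - l) ^+ 2.
  apply: le_trans hvar; rewrite -subr_ge0 -(pmulr_rge0 _ (mulr_gt0 k_gt0 k_gt0)).
  by rewrite -subr_ge0 in hX; move: hX; congr (_ <= _); rewrite /c /m /k; ring.
(* If [X < l <= m], then [m - X] exceeds [m - l >= 0], against the comparison of squares. *)
rewrite leNgt; apply/negP => Xl.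
have : 0 < (l - X) * (m - X + (m - l)) by rewrite mulr_gt0 // /m; lra.
by move: hX; lra.
Qed.

(** * Cosine estimates and the quadratic behind [N_min] *)

(** The triple-angle formula gives [4 c^3 - 3 c + 1 = (c + 1) (2 c - 1)^2 = 0], and [c > 0] excludes
    the root [-1]. *)
Lemma cos_pi3 (R : realType) : cos (pi / 3) = 1 / 2 :> R.
Proof.
set t := pi / 3; set c := cos t.
have pi_gt0 := pi_gt0 R.
have c_gt0 : 0 < c by apply: cos_gt0_pihalf; rewrite /t; apply/andP; split; lra.
have : cos (t + (t + t)) = -1 by have -> : t + (t + t) = pi :> R; [rewrite /t; lra|exact: cospi].
rewrite cosD sinD (cosD t t) -/c; set s := sin t => h.
have cs : c ^+ 2 + s ^+ 2 = 1 by exact: cos2Dsin2.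
have : (c + 1) * (2 * c - 1) ^+ 2 = 0.
  have s2 : s ^+ 2 = 1 - c ^+ 2 by lra.
  have : 4 * c ^+ 3 - 3 * c = -1.
    rewrite -h.
    have -> : c * (c * c - s * s) - s * (s * c + c * s) = c ^+ 3 - 3 * c * s ^+ 2 by ring.
    by rewrite s2; ring.
  by lra.
move=> /eqP; rewrite mulf_eq0 expf_eq0 /= => /orP[/eqP|/eqP]; lra.
Qed.

(** From [n = 4] on, the cosine is nonnegative and [n >= 4] suffices; [n = 3] needs the exact value
    of [cos (pi / 3)]. *)
Lemma cos_pi_n_bounds (R : realType) n : (2 < n)%N ->
  0 <= 1 - cos (pi / n%:R) :> R /\ 4 * (1 - cos (pi / n%:R)) <= n%:R :> R.
Proof.
move=> n_gt2; split; first by rewrite subr_ge0 cos_le1.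
have pi_gt0 := pi_gt0 R.
have [->|n3] := eqVneq n 3; first by rewrite cos_pi3; lra.
have n_ge4 : (4 <= n%:R :> R) by rewrite ler_nat ltn_neqAle eq_sym n3.
suff : 0 <= cos (pi / n%:R) :> R by lra.
apply: cos_ge0_pihalf; apply/andP; split.
  by apply: (@le_trans _ _ 0); [lra | rewrite divr_ge0 ?ler0n // ltW].
by rewrite ler_pM2l // lef_pV2 ?posrE; lra.
Qed.

(* The bound on [(1 - p) ^ N] is the smaller root of
   [n (3n - 4) x^2 - 4n (n - 1 - c) x + (n - 2c)^2], which equals
   [(n (1 - x) - 2c)^2 - 2n (n - 2) x (1 - x)], where [c = 1 - cos (pi / n)]. *)
Lemma N_min_variance (R : realType) (n N : nat) (p : R)
    (P := 1 - (1 - p) ^+ N) :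
  (2 < n)%N -> 0 < p -> p < 1 -> N_min R n p <= N%:R ->
  lambda_min R n <= n%:R * P /\
  2 * n%:R * (n%:R - 2) * P * (1 - P) <= (n%:R * P - lambda_min R n) ^+ 2.
Proof.
move=> n_gt2 p0 p1; have [] := cos_pi_n_bounds R n n_gt2.
rewrite /P /N_min /tau /lambda_min /=.
have -> : 4 * n%:R ^+ 2 + 4 * n%:R * cos (pi / n%:R) =
   4 * n%:R ^+ 2 + 4 * n%:R * (1 - (1 - cos (pi / n%:R))) :> R by ring.
set c := 1 - cos _; set x := (1 - p) ^+ N.
have n3 : 3 <= n%:R :> R by rewrite ler_nat.
move: n%:R n3 => v v3 c0 cv.
set d := (X in Num.sqrt X); set t := Num.sqrt d.
set A := 4 * v * (v - 1 - c); set B := 2 * v * (3 * v - 4).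
have -> : 4 * v ^+ 2 + 4 * v * (1 - c) - t - 8 * v = A - t by rewrite /A; ring.
have -> : 6 * v ^+ 2 - 8 * v = B by rewrite /B; ring.
have B_gt0 : 0 < B by rewrite /B !mulr_gt0 //; lra.
have A_gt0 : 0 < A by rewrite /A !mulr_gt0 //; lra.
have d_ge0 : 0 <= d.
  have -> : d = 4 * v ^+ 2 * (v - 2) ^+ 2 + 16 * v * (v - 2) * (c * (v - 2 * c)).
    by rewrite /d; ring.
  apply: addr_ge0; first by rewrite mulr_ge0 ?sqr_ge0 // mulr_ge0 ?sqr_ge0.
  by rewrite !mulr_ge0 //; lra.
have t2 : t ^+ 2 = d by rewrite sqr_sqrtr.
have t0 : 0 <= t by apply: sqrtr_ge0.
have disc : A ^+ 2 - d = 2 * B * (v - 2 * c) ^+ 2 by rewrite /A /B /d; ring.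
have tA : t < A.
  rewrite -(ltr_pXn2r (n := 2)) ?nnegrE // ?ltW // t2 -subr_gt0 disc.
  by rewrite !mulr_gt0 //; lra.
have q0 : 0 < 1 - p by lra.
have r_gt0 : 0 < (A - t) / B by rewrite divr_gt0 // subr_gt0.
have lnq : ln (1 - p) < 0 by apply/ln_lt0/andP; split=> //; lra.
rewrite ler_ndivrMr // [X in X <= _]mulr_natl -lnXn // ler_ln ?posrE ?exprn_gt0 //.
rewrite -/x ler_pdivlMr // => xr.
(* Already [x <= A / B] suffices: the margin is governed by [(v - 2) (v - 4 c)], which is where
   [4 c <= v] enters. *)
have vx : v * x <= v - 2 * c.
  have : 0 <= (v - 2) * (v - 4 * c) by rewrite mulr_ge0 //; lra.
  have : 2 * (v * x * (3 * v - 4)) <= A by move: xr; rewrite /B; lra.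
  rewrite /A => h1 h2; rewrite -(ler_pM2r (_ : 0 < 3 * v - 4)); lra.
split; first by lra.
have : t ^+ 2 <= (A - B * x) ^+ 2 by rewrite ler_pXn2r ?nnegrE //; lra.
rewrite t2 -subr_ge0 => h.
rewrite -subr_ge0 -(pmulr_rge0 _ (_ : 0 < 2 * B)); last by lra.
by move: h; congr (_ <= _); rewrite /A /B /d; ring.
Qed.

Theorem theorem2 (R : realType) (n N : nat) (p : R) :
  (2 < n)%N -> 0 < p -> p < 1 ->
  N_min R n p <= N%:R ->
  lambda_min R n <= exp_lambda2_union R n N p.
Proof.
move=> n_gt2 p0 p1 hN; have [hl hv] := N_min_variance R n N p n_gt2 p0 p1 hN.
by apply: expect_lambda2_ge hl hv; rewrite ?ltW ?(ltn_trans _ n_gt2).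
Qed.
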